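(* Let $A=\bigoplus_{\alpha\in I}F_\alpha$ be the direct sum of an infinite family $\{F_\alpha\}_{\alpha\in I}$ of non-trivial finite abelian groups. Then there exists a $T$-sequence $\{d_k\}$ in $A$ such that $A\{d_k\}$ is almost maximally almost-periodic.
   Context: A sequence $\{a_n\}$ in a group $G$ is a $T$-sequence if there is a Hausdorff group topology $\tau$ on $G$ such that $a_n\to 0$ (the neutral element) in $\tau$. In this case $G\{a_n\}$ denotes $G$ equipped with the finest group topology in which $a_n\to 0$. For an abelian topological group $A$, the von Neumann radical is $\mathbf n(A)=\bigcap_{\chi}\ker\chi$, where $\chi$ ranges over all continuous homomorphisms $\chi\colon A\to\mathbb T=\mathbb R/\mathbb Z$. A Hausdorff topological group is almost maximally almost-periodic if its von Neumann radical is non-trivial and finite. *)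

(* Defs.v *)
From HB Require Import structures.
From mathcomp Require Import all_boot all_order all_algebra.
From mathcomp Require Import all_classical all_reals all_analysis.

Set Implicit Arguments.
Unset Strict Implicit.
Unset Printing Implicit Defensive.

Import Order.TTheory GRing.Theory Num.Theory.
Import numFieldTopology.Exports.

Local Open Scope classical_set_scope.
Local Open Scope ring_scope.

Section DirectSum.
Variables (I : Type) (F : I -> zmodType).

Definition dsupport (f : forall i, F i) : set I := [set i | f i != 0].

Record direct_sum := DirectSum {
  dsum_fun :> forall i, F i;
  dsum_finite : `[< finite_set (dsupport dsum_fun) >] }.

HB.instance Definition _ := [isSub for dsum_fun].
HB.instance Definition _ := [Choice of direct_sum by <:].

Lemma dsupport0 : `[< finite_set (dsupport (fun i => 0 : F i)) >].
Proof.
apply/asboolP; rewrite (_ : dsupport _ = set0); first exact: finite_set0.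
by apply/seteqP; split=> i //=; rewrite /dsupport /= eqxx.
Qed.

Lemma dsupportN (f : direct_sum) :
  `[< finite_set (dsupport (fun i => - f i)) >].
Proof.
apply/asboolP; move/asboolP: (dsum_finite f); apply: sub_finite_set => i.
by rewrite /dsupport /= oppr_eq0.
Qed.

Lemma dsupportD (f g : direct_sum) :
  `[< finite_set (dsupport (fun i => f i + g i)) >].
Proof.
apply/asboolP; move/asboolP: (dsum_finite f) => ff.
move/asboolP: (dsum_finite g) => fg.
apply: (@sub_finite_set _ _ (dsupport f `|` dsupport g)); last first.
  by rewrite finite_setU.
move=> i; rewrite /dsupport /=; have [->|] := eqVneq (f i) 0; last by left.
by rewrite add0r; right.
Qed.

Definition dsum0 := DirectSum dsupport0.
Definition dsumN (f : direct_sum) := DirectSum (dsupportN f).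
Definition dsumD (f g : direct_sum) := DirectSum (dsupportD f g).

Lemma dsum_ext (f g : direct_sum) : (forall i, f i = g i) -> f = g.
Proof. by move=> fg; apply: val_inj; apply: functional_extensionality_dep. Qed.

Lemma dsumA : associative dsumD.
Proof. by move=> f g h; apply: dsum_ext => i; apply: addrA. Qed.

Lemma dsumC : commutative dsumD.
Proof. by move=> f g; apply: dsum_ext => i; apply: addrC. Qed.

Lemma dsum0r : left_id dsum0 dsumD.
Proof. by move=> f; apply: dsum_ext => i; apply: add0r. Qed.

Lemma dsumNr : left_inverse dsum0 dsumN dsumD.
Proof. by move=> f; apply: dsum_ext => i; apply: addNr. Qed.

HB.instance Definition _ :=
  GRing.isZmodule.Build direct_sum dsumA dsumC dsum0r dsumNr.

End DirectSum.

(* Topologies on a fixed carrier, so that several of them can be compared. *)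
Record topology_on (T : Type) := TopologyOn {
  opens : set_system T;
  opensT : opens setT;
  opensI : setI_closed opens;
  opens_bigcup : forall (J : Type) (f : J -> set T),
    (forall j, opens (f j)) -> opens (\bigcup_j f j) }.

(* The carrier G, seen as a topological space through tau. *)
Definition carrier_with (G : zmodType) (tau : topology_on G) : Type := G.

HB.instance Definition _ (G : zmodType) (tau : topology_on G) :=
  GRing.Zmodule.copy (carrier_with tau) G.
HB.instance Definition _ (G : zmodType) (tau : topology_on G) :=
  isOpenTopological.Build (carrier_with tau)
    (@opensT _ tau) (@opensI _ tau) (@opens_bigcup _ tau).

Record group_topology (G : zmodType) := GroupTopology {
  gt_topology :> topology_on G;
  gt_sub_continuous : continuous
    (fun x : carrier_with gt_topology * carrier_with gt_topology =>
       (x.1 - x.2 : carrier_with gt_topology)) }.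

(* The carrier G, seen as a topological group through tau. *)
Definition group_with (G : zmodType) (tau : group_topology G) : Type :=
  carrier_with tau.

HB.instance Definition _ (G : zmodType) (tau : group_topology G) :=
  GRing.Zmodule.on (group_with tau).
HB.instance Definition _ (G : zmodType) (tau : group_topology G) :=
  Topological.copy (group_with tau) (carrier_with tau).
HB.instance Definition _ (G : zmodType) (tau : group_topology G) :=
  PreTopologicalNmodule_isTopologicalZmodule.Build (group_with tau)
    (@gt_sub_continuous G tau).

Definition converges_to_0 (G : zmodType) (tau : group_topology G)
    (a : nat -> G) : Prop :=
  (a : nat -> group_with tau) @ \oo --> (0 : group_with tau).

Definition T_sequence (G : zmodType) (a : nat -> G) : Prop :=
  exists tau : group_topology G,
    hausdorff_space (group_with tau) /\ converges_to_0 tau a.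

(* tau is the (necessarily unique) topology of G{a_n}. *)
Definition finest_with_limit_0 (G : zmodType) (a : nat -> G)
    (tau : group_topology G) : Prop :=
  converges_to_0 tau a /\
  forall sigma : group_topology G,
    converges_to_0 sigma a -> opens sigma `<=` opens tau.

Section Circle.
Variable R : realType.

Definition is_integer : {pred R} := fun x => x \is a Num.int.

Lemma is_integer_zmod_closed : zmod_closed is_integer.
Proof. by split; [exact: rpred0 | exact: rpredB]. Qed.

HB.instance Definition _ :=
  GRing.isZmodClosed.Build R is_integer is_integer_zmod_closed.

(* R/Z: a group by the algebraic quotient, a space by the quotient topology. *)
Definition circle : Type :=
  quotient_topology {ideal_quot (is_integer : zmodClosed R)}.

HB.instance Definition _ := Topological.copy circle
  (quotient_topology {ideal_quot (is_integer : zmodClosed R)}).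
HB.instance Definition _ := GRing.isZmodule.Build circle
  (@Quotient.addqA _ _) (@Quotient.addqC _ _)
  (@Quotient.add0q _ _) (@Quotient.addNq _ _).

End Circle.

Definition von_neumann_radical (R : realType) (A : topologicalZmodType) :
    set A :=
  [set x | forall chi : {additive A -> circle R}, continuous chi -> chi x = 0].
Arguments von_neumann_radical : clear implicits.

Definition almost_maximally_almost_periodic (R : realType)
    (A : topologicalZmodType) : Prop :=
  [/\ hausdorff_space A,
      von_neumann_radical R A <> [set 0] &
      finite_set (von_neumann_radical R A)].

(* Main.v *)
From HB Require Import structures.
Require Import Defs.
From mathcomp Require Import all_boot all_order all_algebra.
From mathcomp Require Import fingroup cyclic algC cyclotomic classfun character.
From mathcomp Require Import all_classical all_reals all_analysis.
From mathcomp Require Import ring lra zify.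

(* Choose distinct indices i 0, i 1, ... and e k in F (i k), e 0 <> 0, such that
   m e_k = 0 with |m| <= k forces m e_0 = 0. The sequence d lists, for n = 0, 1, ...,
   the relator e_0 - sum_(2^n <= k < 2^(n+1)) e_k and all elements of F (i (n+1)).

   Since the circle has no small subgroups, a character tending to 0 along d kills
   F (i k) for large k, hence by the relators kills e_0. Conversely, a character
   factoring through a coordinate j <> i 0 vanishes on d eventually, so the radical
   lies in the finite group F (i 0).

   The finest topology is Hausdorff because coordinates j <> i 0 vanish on d
   eventually, while the elements of F (i 0) are separated from 0 by charging 2^-n
   for each use of the n-th relator or of an element of F (i k), 2^n <= k < 2^(n+1):
   cancelling the 2^n terms of a relator then costs at least 1. *)

Import Order.TTheory GRing.Theory Num.Theory.
Import numFieldTopology.Exports numFieldNormedType.Exports.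

Local Open Scope classical_set_scope.
Local Open Scope ring_scope.

(** * The finest group topology in which a sequence converges to 0 *)

Section FinestTopology.
Context {G : zmodType} (d : nat -> G).

(* Every neighbourhood of 0 in a group topology with d -> 0 starts such a chain, so
   these chains generate the finest one. *)
Definition null_chain (V : nat -> set G) := forall i,
  [/\ V i 0,
      forall x y, V i.+1 x -> V i.+1 y -> V i (x - y) &
      \forall n \near \oo, V i (d n)].

Definition null_nbhs (U : set G) := exists2 V, null_chain V & V 0 `<=` U.

Definition null_open (U : set G) := forall x, U x -> null_nbhs [set z | U (x + z)].

Lemma null_chain_shift V i : null_chain V -> null_chain (fun j => V (i + j)%N).
Proof. by move=> cV j; case: (cV (i + j)%N); rewrite addnS. Qed.

Lemma null_nbhsS U W : U `<=` W -> null_nbhs U -> null_nbhs W.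
Proof. by move=> UW [V cV VU]; exists V => //; exact: subset_trans UW. Qed.

Lemma null_openT : null_open setT.
Proof.
move=> x _; exists (fun=> setT) => // i; split=> //.
by near=> n.
Unshelve. all: by end_near. Qed.

Lemma null_openI : setI_closed null_open.
Proof.
move=> U W oU oW x [/oU [V cV VU] /oW [V' cV' VW]].
exists (fun i => V i `&` V' i); last by move=> z [/VU ? /VW ?]; split.
move=> i; have [V0 VB Vd] := cV i; have [V'0 V'B V'd] := cV' i.
split; first by split.
  by move=> y z [? ?] [? ?]; split; [exact: VB | exact: V'B].
by near=> n; split; near: n.
Unshelve. all: by end_near. Qed.

Lemma null_open_bigcup (J : Type) (f : J -> set G) :
  (forall j, null_open (f j)) -> null_open (\bigcup_j f j).
Proof.
move=> of_ x [j _ /of_]; apply: null_nbhsS => z fz; by exists j.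
Qed.

Definition null_topology := TopologyOn null_openT null_openI null_open_bigcup.

Lemma nbhs_null (x : carrier_with null_topology) (U : set G) :
  nbhs x U <-> null_nbhs [set z | U (x + z)].
Proof.
split.
  rewrite nbhsE => -[B [oB Bx] BU].
  by apply: null_nbhsS (oB x Bx) => z; exact: BU.
move=> [V cV VU]; rewrite nbhsE.
(* The witness is the interior of [U]. It is open because [W 1 + W 2] lies in [W 0]: [- W 2] lies in
   [W 1], as [W 2] contains 0. *)
exists [set y | null_nbhs [set z | U (y + z)]]; last first.
  by move=> y [W cW WU]; rewrite -(addr0 y); apply: WU; case: (cW 0).
split; last by exists V.
move=> y [W cW WU]; exists (fun j => W (1 + j)%N); first exact: null_chain_shift.
move=> w W1; exists (fun j => W (2 + j)%N); first exact: null_chain_shift.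
move=> z W2; rewrite /= -addrA; apply: WU; rewrite -(opprK z).
have [_ W0B _] := cW 0; have [W10 W1B _] := cW 1.
by apply: W0B => //; rewrite -sub0r; apply: W1B => //; case: (cW 2).
Qed.

Lemma null_sub_continuous : continuous
  (fun x : carrier_with null_topology * carrier_with null_topology =>
     (x.1 - x.2 : carrier_with null_topology)).
Proof.
move=> [x y] U /nbhs_null [V cV VU] /=.
have V1 (z : carrier_with null_topology) : nbhs z [set w | V 1 (w - z)].
  apply/nbhs_null; exists (fun j => V (1 + j)%N); first exact: null_chain_shift.
  by move=> w; rewrite /= addrAC subrr add0r.
exists ([set w | V 1 (w - x)], [set w | V 1 (w - y)]); first by split; exact: V1.
move=> [a b] [/= Va Vb]; have [_ VB _] := cV 0.
have := VU _ (VB _ _ Va Vb).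
by rewrite /= (addrC (a - x : G)) opprB addrA subrKA addrAC (addrC (x : G)) subrK.
Qed.

Definition null_group_topology := GroupTopology null_sub_continuous.

Lemma null_finest : finest_with_limit_0 d null_group_topology.
Proof.
split.
  move=> U /nbhs_null [V cV VU]; have [_ _] := cV 0.
  by apply: filterS => n /VU /=; rewrite add0r.
move=> sigma sd U oU x Ux.
pose S := group_with sigma.
(* Stated for all [N], with [setT] as dummy value, so that [choice] yields a function to iterate
   from the translate of [U]. *)
have halve (N : set G) : exists N' : set G, nbhs (0 : S) N ->
    nbhs (0 : S) N' /\ forall y z, N' y -> N' z -> N (y - z).
  have [nN|nN] := pselect (nbhs (0 : S) N); last first.
    by exists setT => /nN.
  have : nbhs ((0 : S) - (0 : S)) N by rewrite subr0.
  move=> /(@sub_continuous S (0, 0)) [[A B] [/= nA nB] AB].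
  exists (A `&` B) => _; split; first exact: filterI.
  by move=> y z [Ay _] [_ Bz]; apply: (AB (y, z)).
have [h hP] := choice halve.
pose V i := iter i h [set z | U (x + z)].
have nV i : nbhs (0 : S) (V i).
  elim: i => [|i IH] /=; last by have [] := hP _ IH.
  have : nbhs ((x : S) + (0 : S)) U by rewrite addr0; apply: open_nbhs_nbhs; split.
  move=> /(@add_continuous S (x, 0)) [[A B] [/= nA nB] AB].
  apply: filterS nB => z Bz; apply: (AB (x, z)); split=> //=.
  exact: nbhs_singleton nA.
exists V => // i; split; first exact: (@nbhs_singleton S).
  by move=> y z; have [_] := hP _ (nV i); apply.
exact: sd (nV i).
Qed.

(** A common point of [p + V 1] and [q + V 1] would put [q - p] in [V 0]. *)
Lemma null_hausdorff :
  (forall x, x != 0 -> exists2 V, null_chain V & ~ V 0 x) ->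
  hausdorff_space (group_with null_group_topology).
Proof.
move=> sep p q pq; apply/eqP/negPn/negP => pNq.
have [|V cV nV] := sep (q - p); first by rewrite subr_eq0 eq_sym.
have V1 (z : carrier_with null_topology) : nbhs z [set w | V 1 (w - z)].
  apply/nbhs_null; exists (fun j => V (1 + j)%N); first exact: null_chain_shift.
  by move=> w; rewrite /= addrAC subrr add0r.
have [w [/= wp wq]] := pq _ _ (V1 p) (V1 q).
apply: nV; have [_ VB _] := cV 0.
by have := VB _ _ wp wq; rewrite opprB addrC addrA subrK.
Qed.

End FinestTopology.

(** * Characters *)

Section Circle.
Local Open Scope quotient_scope.
Context {R : realType}.

Definition circle_of (t : R) : circle R := \pi_{ideal_quot (is_integer (R := R))} t.

Lemma circle_ofE (s t : R) : circle_of s = circle_of t <-> s - t \is a Num.int.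
Proof.
have E : (s - t \is a Num.int) = (s == t %[mod {ideal_quot (is_integer (R := R))}]).
  by rewrite -Quotient.idealrBE.
by rewrite E; split => [st|/eqP//]; apply/eqP.
Qed.

Lemma circle_ofD (s t : R) : circle_of (s + t) = circle_of s + circle_of t.
Proof. by rewrite /circle_of Quotient.pi_add. Qed.

Lemma circle_of0 : circle_of 0 = 0.
Proof. by apply: (addrI (circle_of 0)); rewrite -circle_ofD !addr0. Qed.

Definition circle_ball (e : R) : set (circle R) :=
  [set z | exists2 t, `|t| < e & z = circle_of t].

Lemma circle_ball_nbhs (e : R) : 0 < e -> nbhs (0 : circle R) (circle_ball e).
Proof.
move=> e0; apply: open_nbhs_nbhs; split; last first.
  by exists 0; rewrite ?normr0 // circle_of0.
rewrite [_ (circle_ball e)](_ : _ = open [set t : R | circle_ball e (circle_of t)])//.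
rewrite openE => t [s se /circle_ofE ts].
apply/nbhs_ballP; exists (e - `|s|) => [|u /= tu]; first by rewrite /= subr_gt0.
exists (s + (u - t)); last first.
  by apply/circle_ofE; rewrite (_ : u - _ = t - s)//; ring.
by rewrite (le_lt_trans (ler_normD _ _))// distrC -ltrBrDl.
Qed.

(** Representatives of absolute value below 1/2 are unique, so the one found for radius 1/2 is also
    smaller than every [r]. *)
Lemma circle_ball_sep (z : circle R) : (forall e, 0 < e -> circle_ball e z) -> z = 0.
Proof.
have half_gt0 : 0 < 2^-1 :> R by rewrite invr_gt0.
move=> ze; have [t t2 zt] := ze _ half_gt0.
suff t0 : t = 0 by rewrite zt t0 circle_of0.
apply/eqP; rewrite -normr_eq0 eq_le normr_ge0 andbT; apply/ler_addgt0Pl => r r0.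
have rmin : 0 < Num.min r 2^-1 by rewrite lt_min r0.
have [s] := ze _ rmin.
rewrite lt_min addr0 zt => /andP[sr s2] /circle_ofE /intrP[m mE].
suff m0 : m = 0.
  by move: mE; rewrite m0 mulr0z => /eqP; rewrite subr_eq0 => /eqP ->; exact: ltW.
move: t2 s2; rewrite !ltr_norml => /andP[? ?] /andP[? ?].
have m_lt1 : m%:~R < 1%:~R :> R by rewrite -mE; lra.
have m_gtN1 : (-1)%:~R < m%:~R :> R by rewrite -mE; lra.
by move: m_lt1 m_gtN1; rewrite !ltr_int; lia.
Qed.

(* If z and its iterated doubles all have a representative in ]-1/3, 1/3[, these
   representatives are the doubles t *+ 2 ^ j of the first one. *)
Lemma circle_no_small_subgroup (z : circle R) :
  (forall j, circle_ball 3^-1 (z *+ j)) -> z = 0.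
Proof.
move=> zj; have [t t3 zt] := zj 1%N; rewrite mulr1n in zt.
have tj j : `|t *+ 2 ^ j| < 3^-1 /\ circle_of (t *+ 2 ^ j) = z *+ 2 ^ j.
  elim: j => [|j [IH zE]]; first by rewrite !mulr1n.
  have zE' : circle_of (t *+ 2 ^ j.+1) = z *+ 2 ^ j.+1.
    by rewrite expnSr !mulrnA !mulr2n circle_ofD zE.
  split=> //; have [s s3] := zj (2 ^ j.+1)%N; rewrite -zE' => /circle_ofE.
  rewrite expnSr mulrnA mulr2n; set u := t *+ _ in IH *.
  (* Here [|u + u - s| < 2/3 + 1/3], so this integer is 0. *)
  move: s3 IH; rewrite !ltr_norml => /andP[? ?] /andP[? ?] /intrP[m mE].
  have m_lt1 : m%:~R < 1%:~R :> R by rewrite -mE; lra.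
  have m_gtN1 : (-1)%:~R < m%:~R :> R by rewrite -mE; lra.
  have m0 : m = 0 by move: m_lt1 m_gtN1; rewrite !ltr_int; lia.
  by move: mE; rewrite m0 mulr0z => /eqP; rewrite subr_eq0 => /eqP ->; apply/andP.
suff t0 : t = 0 by rewrite zt t0 circle_of0.
apply/eqP/negPn/negP => tN0.
have /archi_boundP : 0 <= `|t|^-1 by rewrite invr_ge0.
set N := Num.bound _ => tN.
have [+ _] := tj N; rewrite normrMn -mulr_natr => tN3.
have : 1 < `|t| * (2 ^ N)%:R.
  rewrite -ltr_pdivrMl ?normr_gt0// mulr1 (lt_trans tN)// ltr_nat.
  exact: ltn_expl.
lra.
Qed.

End Circle.

(** Irreducible complex characters of an abelian group are linear and their kernels meet trivially.
    The values are powers [z ^+ k] of a primitive [N]-th root of unity, and [k / N] transports them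
    to the circle. *)
Lemma finite_character (R : realType) (F : finZmodType) (y : F) :
  y != 0 -> exists chi : {additive F -> circle R}, chi y <> 0.
Proof.
move=> y0; pose G := [set: F]%G.
have [i ychi] : exists i : Iirr G, y \notin cfker 'chi_i.
  apply/existsP; rewrite -negb_forall; apply: contra y0 => /forallP yk.
  suff : y \in (1%g : {set F}) by rewrite inE.
  by rewrite -(TI_cfker_irr G); apply/finset.bigcapP.
have lin : 'chi_i \is a linear_char.
  by apply/char_abelianP; exact: FinRing.zmod_abelian.
pose N := #|G|; have N0 : (0 < N)%N := cardG_gt0 G.
have [z zP] := C_prim_root_exists N0.
have root x : 'chi_i x ^+ N = 1.
  by rewrite -lin_charX ?inE// expg_cardG ?inE// lin_char1.
pose k x : 'I_N := sval (prim_rootP zP (root x)).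
have kP x : 'chi_i x = z ^+ k x by rewrite /k; case: prim_rootP.
pose chi x : circle R := circle_of ((k x)%:R / N%:R).
have NR : N%:R != 0 :> R by rewrite pnatr_eq0 -lt0n.
(* The class of [n / N] does not depend on the exponent [n], which is fixed only modulo [N]. *)
have chiE x n : 'chi_i x = z ^+ n -> chi x = circle_of (n%:R / N%:R).
  rewrite kP => /eqP; rewrite (eq_prim_root_expr zP) => /eqP kn; apply/circle_ofE.
  rewrite -mulrBl (divn_eq (k x) N) (divn_eq n N) kn !natrD opprD addrACA subrr addr0.
  by rewrite !natrM -mulrBl mulfK// rpredB// ?rpred_nat.
have chiD : zmod_morphism chi.
  move=> u v; apply: (addIr (chi v)); rewrite subrK -circle_ofD -mulrDl -natrD.
  apply/esym/chiE; rewrite exprD -!kP -lin_charM ?inE//.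
  by rewrite -[(_ * _)%g]/(u - v + v) subrK.
pose X := GRing.isZmodMorphism.Build _ _ chi chiD.
exists (HB.pack_for {additive F -> circle R} chi X) => /=.
rewrite -circle_of0 => /circle_ofE; rewrite subr0 => /intrP[m mE].
have m01 : 0 <= m < 1.
  rewrite -(ler_int R) -(ltr_int R) -mE divr_ge0//= ltr_pdivrMr ?ltr0n// mul1r.
  by rewrite ltr_nat.
have m0 : m = 0 by lia.
move: mE; rewrite m0 mulr0z => /eqP; rewrite mulf_eq0 invr_eq0 (negPf NR) orbF.
rewrite pnatr_eq0 => /eqP ky.
by rewrite cfkerEirr inE kP ky expr0 lin_char1// eqxx in ychi.
Qed.

(** * Selection of the generators *)

(** Recursive choice: [U n] is the finite set of points chosen before step [n], and the next one is
    taken outside it. *)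
Lemma injective_selection (I : Type) (S : nat -> set I) :
  (forall k, infinite_set (S k)) ->
  exists2 i : nat -> I, injective i & forall k, S k (i k).
Proof.
move=> Sinf.
have pick (kA : nat * set I) : exists x, finite_set kA.2 -> (S kA.1 `\` kA.2) x.
  have [fA|nA] := pselect (finite_set kA.2).
    have [x Sx] := infinite_setN0 (infinite_setD (Sinf kA.1) fA).
    by exists x.
  by have [x _] := infinite_setN0 (Sinf 0%N); exists x.
have [f fP] := boolp.choice pick.
pose U := fix U n := if n is n'.+1 then f (n', U n') |` U n' else set0.
have Ufin n : finite_set (U n).
  by elim: n => [|n IH] /=; [exact: finite_set0 | rewrite finite_setU; split].
have Umono k n : (k < n)%N -> U n (f (k, U k)).
  elim: n => // n IH; rewrite ltnS leq_eqVlt => /predU1P[->|kn]; first by left.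
  by right; apply: IH.
exists (fun k => f (k, U k)); last by move=> k; have [] := fP (k, U k) (Ufin k).
move=> k n; wlog kn : k n / (k <= n)%N => [wlg kn|].
  by case/orP: (leq_total k n) => ?; [|apply/esym]; apply: wlg.
move: kn; rewrite leq_eqVlt => /predU1P[//|kn] fkn.
by have [_ []] := fP (n, U n) (Ufin n); rewrite -fkn; exact: Umono.
Qed.

(* Either infinitely many e_j have the same order, or infinitely many orders
   exceed any given bound. *)
Lemma torsion_selection (I : Type) (F : I -> finZmodType) :
  infinite_set [set: I] -> (forall j, (1 < #|F j|)%N) ->
  exists (i : nat -> I) (e : forall k, F (i k)), [/\ injective i, e 0%N != 0 &
    forall k (m : int), (`|m| <= k)%N -> e k *~ m = 0 -> e 0%N *~ m = 0].
Proof.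
move=> Iinf Fnt.
have nz j : exists e : F j, e != 0.
  have /card_gt1P[x [y [_ _ xy]]] := Fnt j.
  by case: (eqVneq x 0) xy => [->|x0 _]; [exists y; rewrite eq_sym | exists x].
pose e j := sval (cid (nz j)).
have e0 j : e j != 0 := svalP (cid (nz j)).
pose o j := #[e j]%g.
have oP j (m : int) : (e j *~ m == 0) = (o j %| `|m|)%N.
  rewrite /o order_dvdn FinRing.zmodXgE FinRing.zmod1gE.
  by case: m => n //; rewrite NegzE abszN mulrNz oppr_eq0.
have [[N Ninf]|fib] := pselect (exists N, infinite_set [set j | o j = N]).
  have [i iinj iP] := @injective_selection I (fun=> [set j | o j = N]) (fun=> Ninf).
  exists i, (fun k => e (i k)); split=> // k m _ /eqP; rewrite oP iP => h.
  by apply/eqP; rewrite oP iP.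
have [|i iinj iP] := @injective_selection I (fun k => [set j | (k < o j)%N]).
  (* If only finitely many indices had order above [k], the fibres of [o] over the values up to [k],
     each finite, would make [I] finite. *)
  move=> k kfin; apply: Iinf.
  rewrite (_ : setT = [set j | (k < o j)%N] `|` \bigcup_(N in `I_k.+1) [set j | o j = N]).
    rewrite finite_setU; split=> //; apply: bigcup_finite; first exact: finite_II.
    by move=> N _; apply: contrapT => h; apply: fib; exists N.
  apply/seteqP; split=> // j _; have [|kj] := ltnP k (o j); [by left|right].
  by exists (o j).
exists i, (fun k => e (i k)); split=> // k m mk /eqP; rewrite oP => om.
(* The order of [e (i k)] exceeds [k], hence cannot divide a non-zero [|m| <= k]. *)
suff -> : m = 0 by rewrite mulr0z.
apply/eqP; rewrite -absz_eq0; apply/contraT; rewrite -lt0n => m0.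
by have := dvdn_leq m0 om; rewrite leqNgt (leq_ltn_trans mk (iP k)).
Qed.

(** * Elements of the direct sum supported at one index *)

Section Single.
Context {I : Type} {F : I -> zmodType}.

(** The groups [F j] are different types, so [y] is transported along a proof of [i = j]; [pselect]
    decides this equality classically. *)
Lemma dsum_single_subproof i (y : F i) : `[< finite_set (dsupport (fun j =>
  if pselect (i = j) is left ij then ecast j (F j) ij y else 0 : F j)) >].
Proof.
apply/asboolP; apply: (@sub_finite_set _ _ [set i]); last exact: finite_set1.
by move=> j; rewrite /dsupport /=; case: pselect => [ij _|_ /eqP//]; exact/esym.
Qed.

Definition dsum_single i (y : F i) : direct_sum F := DirectSum (dsum_single_subproof i y).

Lemma dsum_singleE i (y : F i) : dsum_single i y i = y.
Proof. by rewrite /=; case: pselect => // ii; rewrite (Prop_irrelevance ii erefl). Qed.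

Lemma dsum_single_neq i j (y : F i) : i <> j -> dsum_single i y j = 0.
Proof. by move=> ij /=; case: pselect. Qed.

Lemma dsum_single_zmod_morphism i : zmod_morphism (dsum_single i).
Proof.
move=> y z; apply: dsum_ext => j /=.
by case: pselect => [ij|_]; [case: _ / ij | rewrite subr0].
Qed.
HB.instance Definition _ i := GRing.isZmodMorphism.Build _ _ (dsum_single i)
  (dsum_single_zmod_morphism i).

Lemma dsum_subE (f g : direct_sum F) i : (f - g) i = f i - g i.
Proof. by []. Qed.

Definition dsum_proj i (f : direct_sum F) : F i := f i.

Lemma dsum_proj_zmod_morphism i : zmod_morphism (dsum_proj i).
Proof. by []. Qed.
HB.instance Definition _ i := GRing.isZmodMorphism.Build _ _ (dsum_proj i)
  (dsum_proj_zmod_morphism i).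

Lemma dsum_sumE (J : Type) (s : seq J) (f : J -> direct_sum F) i :
  (\sum_(j <- s) f j) i = \sum_(j <- s) f j i.
Proof. exact: (raddf_sum (dsum_proj i)). Qed.

End Single.

(** * Listing finite blocks as a single sequence *)

Section Enumeration.
Context {G : zmodType} (L : nat -> seq G).

(* Codes of no pair, or pointing past the end of a block, yield 0: such padding
   does not affect convergence to 0. *)
Definition seq_of_blocks (n : nat) : G :=
  if pickle_inv n is Some (k, j) then nth 0 (L k) j else 0.

(** Blocks being finite, only finitely many codes point into the first [K] of them. *)
Lemma near_seq_of_blocks (P : set G) : P 0 ->
  (\forall k \near \oo, forall z, z \in L k -> P z) ->
  \forall n \near \oo, P (seq_of_blocks n).
Proof.
move=> P0 [K _ KP].
exists (\max_(k < K) \max_(j < size (L k)) (pickle (k : nat, j : nat)).+1)%N => //.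
move=> n /= nN.
rewrite /seq_of_blocks; case E: (pickle_inv n) => [[k j]|] //.
have [jk|jk] := ltnP j (size (L k)); last by rewrite nth_default.
have [kK|Kk] := ltnP k K; last by apply: (KP k) => //; exact: mem_nth.
have En : pickle (k, j) = n by have := pickle_invK (T := (nat * nat)%type) n; rewrite E.
move: nN; rewrite leqNgt => /negP[]; rewrite -En.
apply: leq_trans (leq_bigmax (Ordinal kK)).
exact: leq_trans (leq_bigmax (Ordinal jk)).
Qed.

(** Finitely many codes lie below [N]; past every block they point into, each entry has a code at
    least [N]. *)
Lemma near_blocks (P : set G) :
  (\forall n \near \oo, P (seq_of_blocks n)) ->
  \forall k \near \oo, forall z, z \in L k -> P z.
Proof.
move=> [N _ NP].
pose c n := if @pickle_inv (nat * nat)%type n is Some (k, _) then k else 0%N.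
exists (\max_(n < N) (c n).+1)%N => // k /= kN z zL.
have := NP (pickle (k, index z (L k))).
rewrite /seq_of_blocks pickleK_inv nth_index//; apply=> /=.
rewrite leqNgt; apply/negP => nN; move: kN; rewrite leqNgt => /negP[].
by apply: leq_trans (leq_bigmax (Ordinal nN)); rewrite /c /= pickleK_inv.
Qed.

End Enumeration.

(** * Separating the elements of F (i 0) from 0 *)

Lemma ler_sum_supp1 (R : numDomainType) (f : nat -> R) (s : seq nat) k c : uniq s ->
  (forall j, j \in s -> j != k -> f j = 0) -> 0 <= c -> f k <= c ->
  \sum_(j <- s) f j <= c.
Proof.
move=> us f0 c0 fk; have [ks|ks] := boolP (k \in s).
  rewrite (bigD1_seq k)//= big_seq_cond big1 ?addr0// => j /andP[js jk].
  exact: f0.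
rewrite big_seq big1// => j js; apply: f0 => //.
by apply: contraNN ks => /eqP <-.
Qed.

Section Separation.
Context {I : Type} {F : I -> zmodType}.
Variables (i : nat -> I) (e : forall k, F (i k)).
Hypothesis i_inj : injective i.
Hypothesis e_torsion :
  forall k (m : int), (`|m| <= k)%N -> e k *~ m = 0 -> e 0%N *~ m = 0.

Local Notation A := (direct_sum F).
Local Notation block n := (index_iota (2 ^ n) (2 ^ n.+1)).

Definition relator (n : nat) : A :=
  dsum_single (i 0%N) (e 0%N) - \sum_(k <- block n) dsum_single (i k) (e k).

Lemma block_gt0 {n k} : k \in block n -> (0 < k)%N.
Proof. by rewrite mem_index_iota => /andP[+ _]; apply: leq_trans; rewrite expn_gt0. Qed.

(** Recovers the block from an index, which makes distinct blocks disjoint. *)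
Lemma block_log {n k} : k \in block n -> trunc_log 2 k = n.
Proof. by rewrite mem_index_iota => nk; apply: trunc_log_eq. Qed.

Lemma relator_eq0 n j : j <> i 0%N -> (forall k, k \in block n -> j <> i k) ->
  relator n j = 0.
Proof.
move=> j0 jb; rewrite /relator.
rewrite dsum_subE dsum_single_neq ?sub0r; last exact/nesym.
rewrite dsum_sumE big_seq big1 ?oppr0// => k kb.
by rewrite dsum_single_neq//; exact/nesym/jb.
Qed.

Lemma relator0 n : relator n (i 0%N) = e 0%N.
Proof.
rewrite dsum_subE dsum_singleE dsum_sumE.
rewrite big_seq big1 ?subr0// => k /block_gt0 k0.
by rewrite dsum_single_neq// => /i_inj kE; rewrite kE in k0.
Qed.

Lemma relator_block n k : k \in block n -> relator n (i k) = - e k.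
Proof.
move=> kb; have k0 := block_gt0 kb.
rewrite dsum_subE dsum_single_neq ?sub0r; last first.
  by move=> /i_inj kE; rewrite -kE in k0.
rewrite dsum_sumE (bigD1_seq k) ?iota_uniq// dsum_singleE.
rewrite big1 => [|j jk]; first by rewrite /= addr0.
by rewrite dsum_single_neq// => /i_inj kE; rewrite kE eqxx in jk.
Qed.

(** On block [n] the relators contribute [- e k *~ m n] at [i k], so the sum counts the coordinates
    that need a further element of [F (i k)]. *)
Definition rel_cost (m : nat -> int) (a : A) (n : nat) : rat :=
  (2 ^ n)%:R^-1 * (`|m n|%N%:R +
    \sum_(k <- block n) (a (i k) + e k *~ m n != 0)%:R).

(* a is a combination of the relators with coefficients m n, plus an element
   vanishing at i 0, of total cost at most eps. *)
Definition rel_small (eps : rat) : set A := [set a : A | exists2 m : nat -> int,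
  \forall M \near \oo, a (i 0%N) = e 0%N *~ (\sum_(n < M) m n) &
  forall M, \sum_(0 <= n < M) rel_cost m a n <= eps].

(** Radii start at 1/2, below the cost 1 forced on a non-zero element of [F (i 0)], and halve at
    each step since costs are subadditive. *)
Definition rel_chain (l : nat) : set A := rel_small (2 ^ l.+1)%:R^-1.

Lemma rel_cost_ge0 m a n : 0 <= rel_cost m a n.
Proof. by rewrite mulr_ge0 ?invr_ge0// addr_ge0// sumr_ge0. Qed.

Lemma rel_costB m m' a b n : rel_cost (fun n => m n - m' n) (a - b) n <=
  rel_cost m a n + rel_cost m' b n.
Proof.
rewrite /rel_cost -mulrDr ler_wpM2l ?invr_ge0// addrACA -big_split /= lerD//.
  by rewrite -natrD ler_nat; lia.
apply: ler_sum => k _; rewrite -natrD ler_nat.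
have -> : (a - b) (i k) + e k *~ (m n - m' n) =
    (a (i k) + e k *~ m n) - (b (i k) + e k *~ m' n).
  by rewrite dsum_subE mulrzBr opprD addrACA.
case: (eqVneq (a (i k) + _) 0) => [->|_]; first by rewrite sub0r oppr_eq0.
by apply: leq_trans (leq_addr _ _); case: (_ == 0).
Qed.

Lemma rel_small0 eps : 0 <= eps -> rel_small eps 0.
Proof.
move=> eps0; exists (fun=> 0) => [|M]; first by near=> M; rewrite big1.
rewrite big1// => n _; rewrite /rel_cost absz0 add0r big1 ?mulr0// => k _.
by rewrite mulr0z addr0 eqxx.
Unshelve. all: by end_near. Qed.

Lemma rel_smallB eps eps' a b :
  rel_small eps a -> rel_small eps' b -> rel_small (eps + eps') (a - b).
Proof.
move=> [m ma mc] [m' mb mc']; exists (fun n => m n - m' n).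
  near=> M; rewrite dsum_subE.
  by rewrite (near ma M)// (near mb M)// sumrB mulrzBr.
move=> M; apply: le_trans (lerD (mc M) (mc' M)).
by rewrite -big_split; apply: ler_sum => n _; exact: rel_costB.
Unshelve. all: by end_near. Qed.

Lemma rel_small_relator n : rel_small (2 ^ n)%:R^-1 (relator n).
Proof.
(* With the single coefficient 1 at [n], every coordinate in block [n] cancels and only the relator
   itself is charged. *)
exists (fun k => (k == n)%:Z).
  near=> M; have nM : (n < M)%N by near: M; exists n.+1.
  rewrite relator0 (bigD1 (Ordinal nM))//= eqxx big1 ?addr0// => k.
  by rewrite -val_eqE /= => /negPf ->.
move=> M; apply: (@ler_sum_supp1 _ _ _ n); rewrite ?iota_uniq ?invr_ge0//.
  move=> k _ kn; rewrite /rel_cost (negPf kn) absz0 add0r big_seq big1 ?mulr0//.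
  move=> j jk; rewrite mulr0z addr0 relator_eq0 ?eqxx//.
    by move/i_inj => j0; have := block_gt0 jk; rewrite j0.
  move=> h hn /i_inj jh; move/eqP: kn; apply.
  by rewrite -(block_log jk) -(block_log hn) jh.
rewrite /rel_cost eqxx absz1 big_seq big1 ?addr0 ?mulr1// => k kn.
by rewrite relator_block// mulr1z addNr eqxx.
Unshelve. all: by end_near. Qed.

Lemma rel_small_single n k (y : F (i k)) :
  k \in block n -> rel_small (2 ^ n)%:R^-1 (dsum_single (i k) y).
Proof.
move=> kn; exists (fun=> 0).
  near=> M; rewrite big1// mulr0z dsum_single_neq// => /i_inj k0.
  by have := block_gt0 kn; rewrite k0.
move=> M; apply: (@ler_sum_supp1 _ _ _ n); rewrite ?iota_uniq ?invr_ge0//.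
  move=> h _ hn; rewrite /rel_cost absz0 add0r big_seq big1 ?mulr0// => j jh.
  rewrite mulr0z addr0 dsum_single_neq ?eqxx// => /i_inj kj.
  by move/eqP: hn; apply; rewrite -(block_log jh) -(block_log kn) kj.
rewrite /rel_cost absz0 add0r -[leRHS]mulr1 ler_wpM2l ?invr_ge0//.
apply: (@ler_sum_supp1 _ _ _ k); rewrite ?iota_uniq//.
  move=> j _ jk; rewrite mulr0z addr0 dsum_single_neq ?eqxx// => /i_inj kj.
  by rewrite kj eqxx in jk.
by case: (_ != _).
Unshelve. all: by end_near. Qed.

Lemma rel_smallS eps eps' : eps <= eps' -> rel_small eps `<=` rel_small eps'.
Proof. by move=> le a [m ma mc]; exists m => // M; exact: le_trans (mc M) le. Qed.

(* Some coefficient m n does not kill e 0. Either |m n| >= 2^n, or m n kills none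
   of the 2^n elements e k in the n-th block: the cost is at least 1. *)
Lemma rel_small_sep eps (a : A) : eps < 1 -> a (i 0%N) <> 0 ->
  (forall k, (0 < k)%N -> a (i k) = 0) -> ~ rel_small eps a.
Proof.
move=> eps1 a0 ak [m [M _ /(_ M (leqnn M)) aM] mc].
have [n mn] : exists n, e 0%N *~ m n != 0.
  apply: contrapT => h; apply: a0; rewrite aM mulrz_sumr big1// => n _.
  by apply/eqP/negPn/negP => mn; apply: h; exists n.
suff : 1 <= rel_cost m a n.
  move=> c1; have := mc n.+1; rewrite big_nat_recr//=.
  have : 0 <= \sum_(0 <= n < n) rel_cost m a n.
    by apply: sumr_ge0 => *; exact: rel_cost_ge0.
  lra.
rewrite /rel_cost ler_pdivlMl ?ltr0n ?expn_gt0// mulr1.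
have [mge|mlt] := leqP (2 ^ n) `|m n|.
  by rewrite -[leLHS]addr0 lerD ?sumr_ge0// ler_nat.
rewrite -[leLHS]add0r lerD//.
rewrite big_seq (eq_bigr (fun=> 1)) => [|k kn].
  rewrite -big_seq big_const_seq count_predT size_iota iter_addr_0.
  by rewrite expnS mul2n -addnn addnK.
rewrite (ak _ (block_gt0 kn)) add0r.
case: eqVneq => // /e_torsion E; move: mn; rewrite E ?eqxx//.
by move: kn; rewrite mem_index_iota; lia.
Qed.

End Separation.

(** * The von Neumann radical *)

Section Radical.
Context {I : Type} {F : I -> finZmodType}.
Variables (i : nat -> I) (e : forall k, F (i k)).
Hypothesis i_inj : injective i.
Hypothesis e_torsion :
  forall k (m : int), (`|m| <= k)%N -> e k *~ m = 0 -> e 0%N *~ m = 0.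

Local Notation A := (direct_sum (fun j => F j)).

Definition radical_block (n : nat) : seq A :=
  relator i e n :: [seq dsum_single (i n.+1) y | y <- enum (F (i n.+1))].

Definition radical_seq : nat -> A := seq_of_blocks radical_block.

Local Notation tau := (null_group_topology radical_seq).

Lemma near_i_neq (j : I) : \forall k \near \oo, forall n, (k <= n)%N -> i n <> j.
Proof.
have [[k0 <-]|h] := pselect (exists k, i k = j).
  exists k0.+1 => // k /= k0k n kn /i_inj nE.
  by move: (leq_trans k0k kn); rewrite nE ltnn.
by exists 0%N => // k _ n _ ij; apply: h; exists n.
Qed.

(** A constant chain works for a subgroup containing almost all terms: relator [n] only involves the
    indices [i 0] and [i k] with [k >= 2^n]. *)
Lemma null_chain_coord (j : I) : j <> i 0%N ->
  null_chain radical_seq (fun=> [set a : A | a j = 0]).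
Proof.
move=> j0 l; split=> //; first by move=> a b /= -> ->; rewrite subr0.
apply: near_seq_of_blocks => //; near=> k => z.
have ik : forall n, (k <= n)%N -> i n <> j by near: k; exact: near_i_neq.
rewrite inE => /predU1P[->|/mapP[y _ ->]]; rewrite /mkset; last first.
  by rewrite dsum_single_neq//; exact: ik.
rewrite relator_eq0// => n; rewrite mem_index_iota => /andP[kn _].
by apply/nesym/ik; apply: leq_trans kn; exact/ltnW/ltn_expl.
Unshelve. all: by end_near. Qed.

Lemma null_chain_rel : null_chain radical_seq (rel_chain i e).
Proof.
move=> l; split; first exact: rel_small0.
  move=> a b al bl; rewrite /rel_chain.
  rewrite (_ : (2 ^ l.+1)%:R^-1 = (2 ^ l.+2)%:R^-1 + (2 ^ l.+2)%:R^-1).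
    exact: rel_smallB.
  by rewrite (expnS 2 l.+1) natrM invfM; lra.
apply: near_seq_of_blocks; first exact: rel_small0.
exists (2 ^ l.+1)%N => // k /= lk z; rewrite inE => /predU1P[->|/mapP[y _ ->]].
  apply: rel_smallS (rel_small_relator i e i_inj k).
  rewrite lef_pV2 ?posrE ?ltr0n ?expn_gt0// ler_nat leq_exp2l//.
  by apply: leq_trans lk; exact/ltnW/ltn_expl.
(* The element sits in the block of [k.+1], whose number [trunc_log 2 k.+1] is at least [l.+1] once
   [k >= 2^(l+1)]. *)
have kn : k.+1 \in index_iota (2 ^ trunc_log 2 k.+1) (2 ^ (trunc_log 2 k.+1).+1).
  by rewrite mem_index_iota trunc_logP//= trunc_log_ltn.
apply: rel_smallS (rel_small_single i e i_inj _ _ y kn).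
rewrite lef_pV2 ?posrE ?ltr0n ?expn_gt0// ler_nat leq_exp2l//.
by apply: trunc_log_max => //; exact: leqW.
Qed.

Lemma radical_hausdorff : hausdorff_space (group_with tau).
Proof.
apply: null_hausdorff => x x0.
(* A non-zero coordinate off [i 0] is detected by a coordinate chain; otherwise [x] lives in
   [F (i 0)] and the costs detect it. *)
have [[j [j0 xj]]|h] := pselect (exists j, j <> i 0%N /\ x j <> 0).
  by exists (fun=> [set a : A | a j = 0]) => //; exact: null_chain_coord.
exists (rel_chain i e); first exact: null_chain_rel.
have xj j : j <> i 0%N -> x j = 0.
  by move=> j0; apply: contrapT => xj; apply: h; exists j.
apply: rel_small_sep => //.
  by move=> xi0; case/eqP: x0; apply: dsum_ext => j; have [->|/xj] := pselect (j = i 0%N).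
by move=> k k0; apply: xj => /i_inj kE; rewrite kE in k0.
Qed.

Lemma e0_in_radical (R : realType) :
  von_neumann_radical R (group_with tau) (dsum_single (i 0%N) (e 0%N)).
Proof.
move=> chi chiC.
have [dtau _] := null_finest radical_seq.
have small r : 0 < r -> \forall k \near \oo, forall z, z \in radical_block k ->
    circle_ball (R := R) r (chi z).
  move=> r0; apply: near_blocks; apply: (dtau (chi @^-1` circle_ball r)).
  by apply: chiC; rewrite raddf0; exact: circle_ball_nbhs.
have chi0 : \forall k \near \oo, forall n (y : F (i n)), (k < n)%N ->
    chi (dsum_single (i n) y) = 0.
  have third_gt0 : 0 < 3^-1 :> R by rewrite invr_gt0.
  have [K _ KP] := small _ third_gt0.
  exists K => // k /= Kk [//|n] y kn; apply: circle_no_small_subgroup => j.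
  (* All multiples of [y] are listed in the same block, so their images all lie in the ball of
     radius 1/3. *)
  rewrite -raddfMn -raddfMn; apply: (KP n) => /=; first exact: leq_trans Kk kn.
  by rewrite inE map_f ?orbT// mem_enum.
(* Indices in block [k] are at least [2^k > k], where [chi] already vanishes. *)
have chir : \forall k \near \oo, chi (relator i e k) = chi (dsum_single (i 0%N) (e 0%N)).
  near=> k; rewrite /relator raddfB raddf_sum big_seq big1 ?subr0// => n.
  rewrite mem_index_iota => /andP[kn _].
  by apply: (near chi0 k) => //; apply: leq_trans kn; exact: ltn_expl.
apply: circle_ball_sep => r r0; near \oo => k.
rewrite -(near chir k)//; apply: (near (small r r0) k) => //.
exact: mem_head.
Unshelve. all: by end_near. Qed.

(** A character of [F j] not killing [x j], composed with coordinate [j], is continuous: it is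
    constant on the cosets of the open subgroup of elements vanishing at [j]. *)
Lemma radical_coord (R : realType) (x : A) (j : I) : j <> i 0%N ->
  von_neumann_radical R (group_with tau) x -> x j = 0.
Proof.
move=> j0 xrad; apply/eqP/negPn/negP => /(finite_character R)[psi]; apply.
pose chi : group_with tau -> circle R := fun a => psi ((a : A) j).
have chiD : zmod_morphism chi by move=> a b; rewrite /chi -raddfB.
pose X := GRing.isZmodMorphism.Build _ _ chi chiD.
apply: (xrad (HB.pack_for {additive (group_with tau) -> circle R} chi X)) => /=.
move=> a U nU; apply/nbhs_null; exists (fun=> [set b : A | b j = 0]).
  exact: null_chain_coord.
move=> b /= bj; rewrite /chi -[((a : A) + b) j]/((a : A) j + b j) bj addr0.
exact: nbhs_singleton nU.
Qed.

Lemma radical_finite (R : realType) :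
  finite_set (von_neumann_radical R (group_with tau)).
Proof.
apply: (@sub_finite_set _ _ (range (dsum_single (F := fun j => F j) (i 0%N)))).
  move=> x xrad; exists ((x : A) (i 0%N)) => //; apply: dsum_ext => j.
  have [<-|ij] := pselect (i 0%N = j); first exact: dsum_singleE.
  by rewrite dsum_single_neq// (radical_coord R x)//; exact/nesym.
apply: finite_image; exact: finite_finset.
Qed.

End Radical.

Theorem theorem3p1 (R : realType) (I : Type) (F : I -> finZmodType)
    (I_infinite : infinite_set [set: I])
    (F_nontrivial : forall i, (1 < #|F i|)%N) :
  exists d : nat -> direct_sum (fun i => F i),
    T_sequence d /\
    exists tau : group_topology (direct_sum (fun i => F i)),
      finest_with_limit_0 d tau /\
      almost_maximally_almost_periodic R (group_with tau).
Proof.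
have [i [e [i_inj e0 e_tor]]] := torsion_selection I F I_infinite F_nontrivial.
have finest := null_finest (radical_seq i e).
have haus := radical_hausdorff i e i_inj e_tor.
exists (radical_seq i e); split.
  by exists (null_group_topology (radical_seq i e)); split=> //; case: finest.
exists (null_group_topology (radical_seq i e)); split=> //; split=> //.
  move=> rad0; have := e0_in_radical i e R; rewrite rad0 => /= single0.
  case/eqP: e0; rewrite -(dsum_singleE (F := fun j => F j) (i 0%N) (e 0%N)).
  by rewrite single0.
exact: radical_finite.
Qed.
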